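(* Let $S=S[1..n]$ be a string over the alphabet $\Sigma=[1..\sigma]$, let $k\geq 1$, and let $S'=\#^{k-1}S\#^{k-1}$ with $\#\notin\Sigma$. The $k$-attractor problem on $S$ can be reduced to a set-cover instance $\langle\mathcal U,\mathcal S\rangle$ with universe $\mathcal U=\mathcal E(ST^k(S))$ and a set collection $\mathcal S$ of size $|\mathcal L(ST^{2k-1}(S'))|$. Concretely, let $\mathcal C=\{\min(I) : I\in[1..n]/\equiv_k\}$, for $i\in\mathcal C$ let $s_i=\{e\in\mathcal E(ST^k(S)) : i \text{ marks } e\}$, and let $\mathcal S=\{s_i : i\in\mathcal C\}$. Then $|\mathcal S|=|\mathcal L(ST^{2k-1}(S'))|$; for every subcollection $\{s_{i_1},\dots,s_{i_\gamma}\}\subseteq\mathcal S$ covering $\mathcal U$, the set $\{i_1,\dots,i_\gamma\}$ is a $k$-attractor of $S$; and for every minimal $k$-attractor $\Gamma$ of $S$ there is a subcollection of $\mathcal S$ of size $|\Gamma|$ covering $\mathcal U$.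
   Context: A set $\Gamma\subseteq[1..n]$ is a $k$-attractor of $S$ if every substring $S[i..j]$ with $i\leq j<i+k$ has an occurrence $S[i'..j']=S[i..j]$ with $j''\in[i'..j']$ for some $j''\in\Gamma$. It is a minimal $k$-attractor if moreover $\Gamma\setminus\{j\}$ is not a $k$-attractor for every $j\in\Gamma$. For an edge $e=\langle u,v\rangle$ of the suffix tree of $S$, $s(e)$ denotes the string read from the root to the first character of the label of $e$, and $\lambda(e)=|s(e)|$. A position $j$ marks $e$ if there is an occurrence $S[i..i+\lambda(e)-1]=s(e)$ with $i\leq j<i+\lambda(e)$. $ST^k(X)$ denotes the $k$-truncated suffix tree of a string $X$ (the compact trie of all substrings of $X$ of length at most $k$); $\mathcal E(ST^k(S))$ is its edge set, identified with the set of suffix-tree edges $e$ of $S$ with $\lambda(e)\leq k$. For a compact trie $\mathcal T$, $\mathcal L(\mathcal T)$ is the set of leaves whose string depth equals the maximum string depth among all leaves. Two positions $i,j\in[1..n]$ are $k$-equivalent, $i\equiv_k j$, iff $S''[i-k+1..i+k-1]=S''[j-k+1..j+k-1]$, where $S''[p]=\#$ if $p<1$ or $p>n$ and $S''[p]=S[p]$ otherwise; $[1..n]/\equiv_k$ is the set of its equivalence classes.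
   Formalization: The collection is read as a family indexed by C, so its size is |C| (as a plain set the size claim fails for S=aa, k=2); suffixes of S count as explicit nodes of the suffix tree (otherwise S=abcba, k=5 is a counterexample); S is nonempty. *)

(* Defs.v *)
From HB Require Import structures.
From mathcomp Require Import all_boot all_order all_algebra finmap.

Set Implicit Arguments.
Unset Strict Implicit.
Unset Printing Implicit Defensive.

Local Open Scope fset_scope.

(* Strings are 0-indexed: the position p of [1..n] is the ordinal p-1 : 'I_n.
   [factor X i j] is X[i..j], both ends included. *)
Definition factor (A : Type) (X : seq A) (i j : nat) : seq A :=
  take (j.+1 - i) (drop i X).

(* A node is identified with the string spelled on the path from the root, so
   its string depth is its size; an edge is the pair of its end nodes. *)
Record compact_trie (A : choiceType) := CompactTrie {
  ct_nodes : {fset seq A};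
  ct_edges : {fset (seq A * seq A)%type}
}.

Section CompactTrie.
Variable A : choiceType.
Implicit Types (W : {fset seq A}) (T : compact_trie A) (e : seq A * seq A).

Definition proper_prefix (u v : seq A) : bool := prefix u v && (u != v).

Definition trie_strings W : {fset seq A} :=
  [::] |` [fset take p.2 p.1 | p in
            [seq (w, l) | w <- enum_fset W, l <- iota 0 (size w).+1]].

Definition branching W (u : seq A) : bool :=
  [exists v : trie_strings W, exists w : trie_strings W,
     [&& prefix u (val v), prefix u (val w), size (val v) == (size u).+1,
         size (val w) == (size u).+1 & val v != val w]].

(* The nodes kept by path compression: the root, the branching nodes, and the
   strings of W themselves, even those that are prefixes of other strings of W
   (no end marker is assumed). *)
Definition explicit_nodes W : {fset seq A} :=
  [fset u in trie_strings W | [|| u == [::], u \in W | branching W u]].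

Definition compact_trie_of W : compact_trie A :=
  let V := explicit_nodes W in
  CompactTrie V
    [fset e in V `*` V | proper_prefix e.1 e.2 &&
       ~~ [exists w : V, proper_prefix e.1 (val w)
                         && proper_prefix (val w) e.2]].

(* s(e) and lambda(e) *)
Definition edge_string e : seq A := take (size e.1).+1 e.2.
Definition edge_length e : nat := size (edge_string e).

Definition ct_leaves T : {fset seq A} :=
  [fset v in ct_nodes T | ~~ [exists e : ct_edges T, (val e).1 == v]].

Definition deepest_leaves T : {fset seq A} :=
  [fset v in ct_leaves T | size v == \max_(w <- ct_leaves T) size w].

(* ST^k(X): compact trie of the suffixes of X truncated to length k. Its paths
   spell exactly the substrings of X of length at most k. For k >= size X this
   is the suffix tree of X, and in general its edges e = <u, v> are the
   suffix-tree edges with lambda(e) <= k, with v cut at string depth k. *)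
Definition truncated_suffix_tree (k : nat) (X : seq A) : compact_trie A :=
  compact_trie_of [fset take k (drop i X) | i in iota 0 (size X)].

End CompactTrie.

Section Attractor.
Variables (A : choiceType) (n k : nat) (S : n.-tuple A).
Implicit Types (G : {set 'I_n}) (i j : 'I_n).

Definition k_attractor G : Prop :=
  forall i j, i <= j < i + k ->
  exists i' j', [/\ i' <= j', factor S i' j' = factor S i j
                  & exists2 p, p \in G & i' <= p <= j'].

Definition minimal_k_attractor G : Prop :=
  k_attractor G /\ forall j, j \in G -> ~ k_attractor (G :\ j)%SET.

Definition marks (j : 'I_n) (e : seq A * seq A) : bool :=
  [exists i : 'I_n,
     [&& i + edge_length e <= n,
         factor S i (i + edge_length e).-1 == edge_string e
       & i <= j < i + edge_length e]].

(* S''[p], with None in the role of # *)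
Definition hash_ext (p : int) : option A :=
  if p is Posz m then onth S m else None.

(* S''[i-k+1..i+k-1] (for k >= 1) *)
Definition window (i : 'I_n) : seq (option A) :=
  [seq hash_ext (i%:Z - k.-1%:Z + t%:Z)%R | t <- iota 0 (2 * k).-1].

Definition k_equiv (i j : 'I_n) : bool := window i == window j.

Definition k_classes : {set {set 'I_n}} :=
  equivalence_partition k_equiv [set: 'I_n]%SET.

Definition class_minima : {set 'I_n} :=
  [set i | [exists I in k_classes, (i \in I) && [forall j in I, i <= j]]]%SET.

(* S' = #^(k-1) S #^(k-1) *)
Definition hash_pad : seq (option A) :=
  nseq k.-1 None ++ map Some S ++ nseq k.-1 None.

End Attractor.

(* The collection is a family indexed by a finite set, i.e. a multiset: sets
   with distinct indices count separately even when they are equal. *)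
Record set_cover (T : choiceType) (I : finType) := SetCover {
  sc_universe : {fset T};
  sc_index : {set I};
  sc_family : I -> {fset T}
}.

Definition sc_size (T : choiceType) (I : finType) (P : set_cover T I) : nat :=
  #|sc_index P|.

Definition sc_covers (T : choiceType) (I : finType) (P : set_cover T I)
    (D : {set I}) : Prop :=
  D \subset sc_index P /\
  sc_universe P `<=` \bigcup_(i in D) sc_family P i.

Definition attractor_set_cover (A : choiceType) (n k : nat) (S : n.-tuple A) :=
  let U := ct_edges (truncated_suffix_tree k S) in
  SetCover U (class_minima k S) (fun i => [fset e in U | marks S i e]).

(* Main.v *)
(** An edge [e] of the truncated suffix tree spells strings whose proper
    extensions inside [e] are forced: every occurrence of [edge_string e] extends
    to one of [e.2]. A substring of length at most [k] has its locus inside some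
    edge [e], so marking every edge is the same as being a [k]-attractor.
    An occurrence of length at most [k] through a position lies within that
    position's window, hence equivalent positions mark the same edges. A minimal
    attractor therefore contains at most one position per class, and replacing
    each position by the minimum of its class keeps both the size and the cover.
    The windows are the substrings of length [2k-1] of the padded string, which
    are the deepest leaves of its truncated suffix tree. *)

Require Import Defs.
From HB Require Import structures.
From mathcomp Require Import all_boot all_order all_algebra finmap.
From mathcomp Require Import zify.

Set Implicit Arguments.
Unset Strict Implicit.
Unset Printing Implicit Defensive.

Local Open Scope fset_scope.

(** * Prefix order on strings *)

Section Prefixes.
Variable A : choiceType.
Implicit Types (u v w x y : seq A).

Lemma prefix_comparable u v x :
  prefix u x -> prefix v x -> size u <= size v -> prefix u v.
Proof.
rewrite !prefixE => /eqP ux /eqP vx le_uv.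
by rewrite -vx take_takel // ux.
Qed.

Lemma proper_prefixE u v :
  proper_prefix u v = prefix u v && (size u < size v).
Proof.
rewrite /proper_prefix; case uv: (prefix u v) => //=.
have le_uv := size_prefix uv; move: uv; rewrite prefixE => /eqP uv.
rewrite ltn_neqAle le_uv andbT; congr negb; apply/eqP/eqP => [-> // | eq_uv].
by rewrite -uv eq_uv take_size.
Qed.

End Prefixes.

(** * Compact tries: explicit nodes, edges, loci and deepest leaves *)

Section CompactTrieTheory.
Variables (A : choiceType) (W : {fset seq A}).
Implicit Types (u v w x y : seq A) (e : seq A * seq A).
Let T := compact_trie_of W.

Lemma trie_stringsP u :
  reflect (u = [::] \/ exists2 w, w \in W & prefix u w) (u \in trie_strings W).
Proof.
rewrite in_fset1U; apply: (iffP orP) => -[].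
- by move/eqP; left.
- case/imfsetP => -[w l] /allpairsPdep[w' [l' [Ww _ [-> ->]]]] ->.
  by right; exists w'; rewrite ?prefix_take.
- by move=> ->; left.
case=> w Ww uw; right; apply/imfsetP; exists (w, size u); last first.
  by apply/esym/eqP; rewrite -prefixE.
apply/allpairsPdep; exists w, (size u); split=> //.
by rewrite mem_iota add0n ltnS size_prefix.
Qed.

Lemma in_explicit_nodes u :
  (u \in explicit_nodes W) =
  (u \in trie_strings W) && [|| u == [::], u \in W | branching W u].
Proof. by rewrite [LHS]in_fset. Qed.

Lemma mem_explicit_nodes w : w \in W -> w \in explicit_nodes W.
Proof.
move=> Ww; rewrite in_explicit_nodes Ww orbT andbT.
by apply/trie_stringsP; right; exists w => //; exact: prefix_refl.
Qed.

Lemma nil_explicit_nodes : [::] \in explicit_nodes W.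
Proof. by rewrite in_explicit_nodes andbT; apply/trie_stringsP; left. Qed.

Lemma explicit_node_prefix u :
  u \in explicit_nodes W -> u = [::] \/ exists2 w, w \in W & prefix u w.
Proof. by rewrite in_explicit_nodes => /andP[/trie_stringsP]. Qed.

Lemma branching_explicit_nodes u x y :
  x \in W -> y \in W -> prefix u x -> prefix u y ->
  size u < size x -> size u < size y ->
  take (size u).+1 x != take (size u).+1 y -> u \in explicit_nodes W.
Proof.
move=> Wx Wy ux uy lt_ux lt_uy neq_xy.
have Tu : u \in trie_strings W by apply/trie_stringsP; right; exists x.
have T_take z : z \in W -> take (size u).+1 z \in trie_strings W.
  by move=> Wz; apply/trie_stringsP; right; exists z; rewrite ?prefix_take.
have pre_take z : prefix u z -> prefix u (take (size u).+1 z).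
  by rewrite !prefixE take_takel.
rewrite in_explicit_nodes Tu /=; apply/orP; right; apply/orP; right.
apply/existsP; exists [` T_take x Wx]; apply/existsP; exists [` T_take y Wy].
by rewrite /= !pre_take //= !size_takel // !eqxx.
Qed.

Lemma ct_edgesP e :
  reflect [/\ e.1 \in explicit_nodes W, e.2 \in explicit_nodes W,
              proper_prefix e.1 e.2
            & forall w, w \in explicit_nodes W ->
              proper_prefix e.1 w -> ~~ proper_prefix w e.2]
          (e \in ct_edges T).
Proof.
rewrite [_ \in ct_edges T]in_fset; apply: (iffP idP).
  case/andP; rewrite in_fsetM => /andP[V1 V2] /andP[ltV /existsPn noV].
  split=> // w Vw lt1.
  by have := noV [` Vw]; rewrite /= lt1.
case=> V1 V2 ltV noV; apply/andP; split; first by rewrite in_fsetM V1.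
rewrite ltV /=.
apply/existsPn => w; apply/negP => /andP[lt1 lt2].
by have := noV _ (valP w) lt1; rewrite lt2.
Qed.

Lemma edge_lengthE e :
  e \in ct_edges T -> edge_length e = (size e.1).+1.
Proof.
case/ct_edgesP => _ _; rewrite proper_prefixE => /andP[_ lt12] _.
by rewrite /edge_length size_takel.
Qed.

(* Every string strictly inside an edge is neither an element of [W] nor
   branching, so it has a unique continuation in the trie. *)
Lemma edge_string_extends e y :
  e \in ct_edges T -> y \in W -> prefix (edge_string e) y -> prefix e.2 y.
Proof.
case: e => u v /ct_edgesP[/= Vu Vv uv noV] Wy; rewrite /edge_string /= => uy.
have [uv' lt_uv] := andP (etrans (esym (proper_prefixE u v)) uv).
have [v0|[x Wx vx]] := explicit_node_prefix Vv.
  by rewrite v0 ltn0 in lt_uv.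
suff ext m : size u < m <= size v -> prefix (take m v) y.
  by rewrite -(take_size v); apply: ext; rewrite lt_uv /=.
elim: m => // m IHm /andP[]; rewrite ltnS leq_eqVlt.
case/predU1P=> [<- // | lt_um lt_mv].
have {IHm} my : prefix (take m v) y by apply: IHm; rewrite lt_um ltnW.
have size_m : size (take m v) = m by rewrite size_takel // ltnW.
have mx : prefix (take m v) x by exact: prefix_trans (prefix_take _ _) vx.
have um : proper_prefix u (take m v).
  rewrite proper_prefixE size_m lt_um andbT.
  by apply: (prefix_comparable uv' (prefix_take _ _)); rewrite size_m ltnW.
have mv : proper_prefix (take m v) v.
  by rewrite proper_prefixE prefix_take size_m.
have Vm : take m v \notin explicit_nodes W.
  by apply/negP => /noV/(_ um); rewrite mv.
(* If [y] stopped here, [take m v] would be [y] itself, an element of [W], hence explicit. *)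
have lt_my : m < size y.
  rewrite ltn_neqAle -{2}size_m size_prefix // andbT.
  apply: contra Vm => /eqP eq_my; move: my.
  rewrite prefixE size_m eq_my take_size.
  by move/eqP <-; exact: mem_explicit_nodes.
have lt_mx : m < size x by exact: leq_trans lt_mv (size_prefix vx).
(* If the next letter of [y] differed from that of [x], which continues along [v], [take m v] would
   be branching. *)
rewrite prefixE size_takel //; apply: contraR Vm => neq.
apply: (branching_explicit_nodes Wx Wy mx my); rewrite size_m //.
suff -> : take m.+1 x = take m.+1 v by rewrite eq_sym.
move: vx; rewrite prefixE => /eqP <-.
by rewrite take_takel.
Qed.

(** The lower end is the longest explicit proper prefix of [w], the upper end the shortest explicit
    prefix of [x] at least as long as [w]. The root and [x] itself are candidates, and an explicit
    node strictly between would contradict one of the two extremal choices. *)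
Lemma edge_locus w x :
  x \in W -> prefix w x -> 0 < size w ->
  exists e, [/\ e \in ct_edges T, proper_prefix e.1 w & prefix w e.2].
Proof.
move=> Wx wx w_gt0.
pose lo m := [&& m < size w & take m w \in explicit_nodes W].
pose hi m := [&& size w <= m <= size x & take m x \in explicit_nodes W].
have ex_lo : exists m, lo m.
  by exists 0; rewrite /lo w_gt0 take0 nil_explicit_nodes.
have ex_hi : exists m, hi m.
  exists (size x).
  by rewrite /hi size_prefix // leqnn take_size mem_explicit_nodes.
have lo_le m : lo m -> m <= size w by case/andP => /ltnW.
case: (ex_maxnP ex_lo lo_le) => a /andP[lt_aw Va] max_a.
case: (ex_minnP ex_hi) => b /andP[/andP[le_wb le_bx] Vb] min_b.
have aw : proper_prefix (take a w) w.
  by rewrite proper_prefixE prefix_take size_takel ?(ltnW lt_aw).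
have wb : prefix w (take b x).
  by move: wx; rewrite !prefixE take_takel.
exists (take a w, take b x); split=> //=; apply/ct_edgesP; split=> //=.
  rewrite proper_prefixE (prefix_trans (prefix_take _ _) wb) /=.
  by rewrite !size_takel ?(ltnW lt_aw) // (leq_trans lt_aw).
move=> z Vz; rewrite !proper_prefixE !size_takel ?(ltnW lt_aw) //.
case/andP=> az lt_az; apply/negP => /andP[zb lt_zb].
have zx : prefix z x by exact: prefix_trans zb (prefix_take _ _).
have [le_wz|lt_zw] := leqP (size w) (size z).
  have : hi (size z).
    rewrite /hi le_wz size_prefix //=.
    by move: zx; rewrite prefixE => /eqP ->.
  by move/min_b; rewrite leqNgt lt_zb.
have : lo (size z).
  rewrite /lo lt_zw /=.
  by have := prefix_comparable zx wx (ltnW lt_zw); rewrite prefixE => /eqP ->.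
by move/max_a; rewrite leqNgt lt_az.
Qed.

Lemma in_deepest_leaves m w0 :
  {in W, forall w, size w <= m} -> w0 \in W -> size w0 = m -> forall w,
  (w \in deepest_leaves T) = (w \in W) && (size w == m).
Proof.
move=> le_m Ww0 size_w0.
have le_nodes u : u \in explicit_nodes W -> size u <= m.
  case/explicit_node_prefix => [->//|[x Wx /size_prefix le_ux]].
  exact: leq_trans le_ux (le_m _ Wx).
have leaf w : w \in W -> size w = m -> w \in ct_leaves T.
  move=> Ww size_w; rewrite in_fset; apply/andP; split.
    exact: mem_explicit_nodes.
  apply/existsPn => -[e Ee] /=; apply/negP => /eqP e1.
  case/ct_edgesP: (Ee) => _ /le_nodes le2.
  by rewrite proper_prefixE e1 size_w ltnNge le2 andbF.
have max_leaves : \max_(w <- ct_leaves T) size w = m.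
  apply/eqP; rewrite eqn_leq; apply/andP; split.
    apply/bigmax_leqP_seq => w; rewrite in_fset => /andP[Vw _] _.
    exact: le_nodes.
  by rewrite -{1}size_w0; apply: leq_bigmax_seq => //; exact: leaf.
move=> w; rewrite in_fset [in_mem _ _]/= max_leaves; apply/andP/andP => -[]; last first.
  by move=> Ww /eqP size_w; split; [exact: leaf|rewrite size_w].
rewrite in_fset => /andP[Vw _] /eqP size_w; split; last by rewrite size_w.
case/explicit_node_prefix: Vw => [w_nil|[x Wx wx]].
  (* A deepest leaf at the root forces [m = 0], so [w0] is the empty string too. *)
  have m0 : m = 0 by rewrite -size_w w_nil.
  suff -> : w = w0 by [].
  by rewrite w_nil; apply/esym/size0nil; rewrite size_w0.
suff -> : w = x by [].
move: (wx); rewrite prefixE => /eqP <-; rewrite take_oversize //.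
by rewrite size_w le_m.
Qed.

End CompactTrieTheory.

(** * Occurrences in [S], marking and windows *)

Section AttractorTheory.
Variables (A : choiceType) (n k : nat) (S : n.-tuple A).
Implicit Types (i j p q : 'I_n) (e : seq A * seq A).
Let W := [fset take k (drop i S) | i in iota 0 (size S)].

Lemma factorE i l : 0 < l -> factor S i (i + l).-1 = take l (drop i S).
Proof. by move=> l_gt0; rewrite /factor; congr take; lia. Qed.

Lemma size_factor i j : i <= j -> size (factor S i j) = j.+1 - i.
Proof.
by move=> le_ij; rewrite size_takel // size_drop size_tuple leq_sub2r.
Qed.

Lemma marksP p e : 0 < edge_length e ->
  reflect (exists i, [/\ i + edge_length e <= n,
             take (edge_length e) (drop i S) = edge_string e
           & i <= p < i + edge_length e]) (marks S p e).
Proof.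
move=> e_gt0; apply: (iffP existsP) => -[i].
  by case/and3P=> le_n; rewrite factorE // => /eqP eq_e ip; exists i.
by case=> le_n eq_e ip; exists i; rewrite factorE // eq_e eqxx le_n.
Qed.

Lemma hash_ext_window p q t : window k S p = window k S q -> t < (2 * k).-1 ->
  hash_ext S (p%:Z - k.-1%:Z + t%:Z)%R = hash_ext S (q%:Z - k.-1%:Z + t%:Z)%R.
Proof.
move=> eq_pq lt_t; have := congr1 (fun s => nth None s t) eq_pq.
by rewrite /window !(nth_map 0) ?size_iota // !nth_iota.
Qed.

(* An occurrence of length at most [k] through [p] lies inside the window of [p]
   and avoids the padding symbol. *)
Lemma occurrence_window p q a l : window k S p = window k S q ->
  l <= k -> a + l <= n -> a <= p < a + l ->
  exists b : 'I_n, [/\ b + l <= n, take l (drop b S) = take l (drop a S)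
                     & b <= q < b + l].
Proof.
move=> eq_pq le_lk le_n /andP[le_ap lt_pa].
(* Position [a + m] has index [k.-1 + a + m - p] in the window of [p]; the subtraction does not
   truncate because [p - a < l <= k]. *)
have eq_onth m : m < l ->
    onth S (a + m) = hash_ext S (q%:Z - p%:Z + a%:Z + m%:Z)%R.
  move=> lt_ml; have := @hash_ext_window p q (k.-1 + a + m - p) eq_pq.
  have -> : (p%:Z - k.-1%:Z + (k.-1 + a + m - p)%N%:Z)%R = Posz (a + m) by lia.
  have -> : (q%:Z - k.-1%:Z + (k.-1 + a + m - p)%N%:Z)%R =
            (q%:Z - p%:Z + a%:Z + m%:Z)%R by lia.
  by apply; lia.
have onth_some m : m < l -> onth S (a + m).
  by move=> ?; rewrite onthTE size_tuple; lia.
(* The shifted start [q - p + a] is not negative: there [hash_ext] would give [None], but [S] has a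
   letter at [a]. *)
have le_pq : p <= q + a.
  rewrite leqNgt; apply/negP => lt_qp.
  have l_gt0 : 0 < l by lia.
  have := onth_some 0 l_gt0; rewrite eq_onth //.
  by case Ez: (_ + _)%R => [z|z] //; lia.
have {}eq_onth m : m < l -> onth S (a + m) = onth S (q + a - p + m).
  move=> lt_ml; rewrite eq_onth //.
  by have -> : (q%:Z - p%:Z + a%:Z + m%:Z)%R = Posz (q + a - p + m) by lia.
have lt_bn : q + a - p < n by have := ltn_ord q; lia.
(* The last letter of the occurrence likewise rules out running past the right end. *)
have le_bn : q + a - p + l <= n.
  have : onth S (q + a - p + l.-1) by rewrite -eq_onth ?onth_some //; lia.
  by rewrite onthTE size_tuple; lia.
exists (Ordinal lt_bn); split=> //=; last by lia.
apply/eq_from_onth_le => m.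
rewrite !size_takel ?size_drop ?size_tuple; try lia.
rewrite maxnn => lt_ml.
rewrite !onthE !map_take !map_drop !nth_take // !nth_drop -!onthE.
by rewrite eq_onth.
Qed.

Lemma marks_window p q e : window k S p = window k S q ->
  0 < edge_length e <= k -> marks S p e -> marks S q e.
Proof.
move=> eq_pq /andP[e_gt0 le_ek] /(marksP _ e_gt0)[a [le_n eq_e ap]].
have [b [le_bn eq_b bq]] := occurrence_window eq_pq le_ek le_n ap.
by apply/marksP => //; exists b; rewrite eq_b.
Qed.

(** * Edges of the truncated suffix tree and attractors *)

Lemma truncated_suffixP w :
  reflect (exists i, w = take k (drop i S)) (w \in W).
Proof.
apply: (iffP (imfsetP _ _ _ _)) => [[i] | [i ->]].
  rewrite [in_mem _ _]mem_iota size_tuple => lt_in ->.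
  by exists (Ordinal lt_in).
by exists (i : nat) => //; rewrite [in_mem _ _]mem_iota size_tuple ltn_ord.
Qed.

Lemma edge_occurs e : e \in ct_edges (truncated_suffix_tree k S) ->
  0 < edge_length e <= k /\
  exists i, i + edge_length e <= n /\
            take (edge_length e) (drop i S) = edge_string e.
Proof.
move=> Ee; have size_e := edge_lengthE Ee.
case/ct_edgesP: Ee => _ V2; rewrite proper_prefixE => /andP[_ lt12] _.
have [e2|[x /truncated_suffixP[i ->] ex]] := explicit_node_prefix V2.
  by rewrite e2 ltn0 in lt12.
have pre_e : prefix (edge_string e) (take k (drop i S)).
  exact: prefix_trans (prefix_take _ _) ex.
have := size_prefix pre_e; rewrite -/(edge_length e).
rewrite size_take_min size_drop size_tuple leq_min => /andP[le_ek le_en].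
split; first by rewrite le_ek size_e.
exists i; split; first by have := ltn_ord i; lia.
by move: pre_e; rewrite prefixE -/(edge_length e) take_takel // => /eqP.
Qed.

(** [edge_string e] is itself a substring of length at most [k], so the attractor condition applies
    to it directly. *)
Lemma attractor_marks (G : {set 'I_n}) e : k_attractor k S G ->
  e \in ct_edges (truncated_suffix_tree k S) ->
  exists2 p, p \in G & marks S p e.
Proof.
move=> attrG /edge_occurs[/andP[e_gt0 le_ek] [i [le_in eq_e]]].
have lt_jn : (i + edge_length e).-1 < n by lia.
have [|i' [j' [le_ij]]] := attrG i (Ordinal lt_jn) _; first by rewrite /=; lia.
rewrite /= factorE // eq_e => eq_ij [p Gp ip].
exists p => //; apply/marksP => //; exists i'.
have size_e : edge_length e = j'.+1 - i' by rewrite -size_factor // eq_ij.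
have := ltn_ord j'; split; [lia | | lia].
by rewrite -eq_ij size_e.
Qed.

Lemma marks_attractor (D : {set 'I_n}) :
  (forall e, e \in ct_edges (truncated_suffix_tree k S) ->
     exists2 p, p \in D & marks S p e) ->
  k_attractor k S D.
Proof.
move=> markD i j /andP[le_ij lt_ji].
have Wx : take k (drop i S) \in W by apply/truncated_suffixP; exists i.
have wx : prefix (factor S i j) (take k (drop i S)).
  rewrite prefixE size_factor // take_takel //; lia.
have [|e [Ee lt1 le2]] := edge_locus Wx wx.
  by rewrite size_factor //; lia.
have [p Dp] := markD e Ee.
have [/andP[e_gt0 le_ek] _] := edge_occurs Ee.
case/(marksP _ e_gt0) => a [le_an eq_e ap].
have Wy : take k (drop a S) \in W by apply/truncated_suffixP; exists a.
have ey : prefix (edge_string e) (take k (drop a S)).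
  by rewrite prefixE -/(edge_length e) take_takel // eq_e.
have wy := prefix_trans le2 (edge_string_extends Ee Wy ey).
(* The marking position falls in the first [edge_length e] letters after [a]; the copy of the factor
   at [a] contains them since the factor is longer than [e.1]. *)
have le_ew : edge_length e <= size (factor S i j).
  by rewrite (edge_lengthE Ee); move: lt1; rewrite proper_prefixE => /andP[].
have := size_prefix wy; rewrite size_factor // in le_ew *.
rewrite size_take_min size_drop size_tuple leq_min => /andP[le_jk le_jn].
have lt_bn : a + (j - i) < n by have := ltn_ord a; lia.
exists a, (Ordinal lt_bn); split=> /=; first by lia.
  move: wy; rewrite prefixE size_factor // take_takel // => /eqP <-.
  by rewrite /factor; congr take; lia.
by exists p => //; lia.
Qed.

(** Every edge marked by [p] is also marked by [q], so [p] is redundant. *)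
Lemma k_attractor_window (G : {set 'I_n}) p q : k_attractor k S G ->
  q \in G -> window k S p = window k S q -> p != q ->
  k_attractor k S (G :\ p)%SET.
Proof.
move=> attrG Gq eq_pq neq_pq; apply: marks_attractor => e Ee.
have [r Gr mark_r] := attractor_marks attrG Ee.
have [e_size _] := edge_occurs Ee.
have [eq_rp|neq_rp] := eqVneq r p; last by exists r => //; rewrite !inE neq_rp.
exists q; first by rewrite !inE eq_sym neq_pq.
by apply: marks_window mark_r; rewrite // eq_rp.
Qed.

(** * Minimal representatives of the window classes *)

Lemma class_minimaP i :
  reflect (forall j, window k S i = window k S j -> i <= j)
          (i \in class_minima k S).
Proof.
rewrite inE; apply: (iffP existsP) => [[I /and3P[]] | min_i].
  case/imsetP => x _ ->; rewrite !inE => /eqP eq_xi /forall_inP min_i j eq_ij.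
  by apply: min_i; rewrite !inE; apply/eqP; rewrite -eq_ij.
exists [set j in [set: 'I_n] | k_equiv k S i j]%SET.
rewrite imset_f ?inE //= /k_equiv eqxx /=; apply/forall_inP => j.
by rewrite !inE => /eqP; exact: min_i.
Qed.

Lemma class_minima_inj : {in class_minima k S &, injective (window k S)}.
Proof.
move=> i j /class_minimaP min_i /class_minimaP min_j eq_ij.
by apply/val_inj/eqP; rewrite eqn_leq min_i // min_j.
Qed.

Definition class_min i : 'I_n :=
  [arg min_(j < i | window k S j == window k S i) j].

Lemma window_class_min i : window k S (class_min i) = window k S i.
Proof. by rewrite /class_min; case: arg_minnP => // j /eqP. Qed.

Lemma class_min_in i : class_min i \in class_minima k S.
Proof.
apply/class_minimaP => j; rewrite window_class_min => eq_ij.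
by rewrite /class_min; case: arg_minnP => // m _; apply; rewrite eq_ij.
Qed.

(** * Windows as substrings of the padded string *)

(** [None] is both the padding symbol and the default of [nth], so the right padding and all indices
    beyond it agree with [onth] past the end of [S]. *)
Lemma nth_hash_pad m :
  nth None (hash_pad k S) m = if m < k.-1 then None else onth S (m - k.-1).
Proof.
rewrite nth_cat size_nseq nth_nseq; case: ltnP => // le_m.
rewrite nth_cat size_map size_tuple onthE nth_nseq if_same.
case: ltnP => // le_n.
by rewrite nth_default // size_map size_tuple.
Qed.

Lemma size_hash_pad : size (hash_pad k S) = (k.-1 + n + k.-1)%N.
Proof. by rewrite !size_cat !size_nseq size_map size_tuple addnA. Qed.

Lemma size_window i : size (window k S i) = (2 * k).-1.
Proof. by rewrite size_map size_iota. Qed.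

(** The left padding shifts positions by [k.-1], so the window centred at [i] starts at index [i] of
    the padded string. *)
Lemma windowE i : 0 < k ->
  window k S i = take (2 * k).-1 (drop i (hash_pad k S)).
Proof.
move=> k_gt0; apply: (@eq_from_nth _ None) => [|t].
  rewrite size_window size_takel // size_drop size_hash_pad.
  by have := ltn_ord i; lia.
rewrite size_window => lt_t.
rewrite (nth_map 0) ?size_iota // nth_iota // nth_take // nth_drop nth_hash_pad.
rewrite add0n; case: ltnP => cmp.
  by case Ez: (_ + _)%R => [z|z] //; lia.
by have -> : (i%:Z - k.-1%:Z + t%:Z)%R = Posz (i + t - k.-1) by lia.
Qed.

Lemma deepest_leaves_windows : 0 < n -> 0 < k ->
  deepest_leaves (truncated_suffix_tree (2 * k).-1 (hash_pad k S)) =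
  [fset window k S i | i in class_minima k S].
Proof.
move=> n_gt0 k_gt0; set X := [fset take (2 * k).-1 (drop i (hash_pad k S))
                             | i in iota 0 (size (hash_pad k S))].
have X_window i : window k S i \in X.
  rewrite windowE //; apply/imfsetP; exists (i : nat) => //.
  by rewrite [in_mem _ _]mem_iota size_hash_pad; have := ltn_ord i; lia.
have le_X : {in X, forall w, size w <= (2 * k).-1}.
  by move=> _ /imfsetP[i _ ->]; rewrite size_take_min geq_minl.
apply/fsetP => w.
rewrite (in_deepest_leaves le_X (X_window (Ordinal n_gt0)) (size_window _)).
apply/andP/imfsetP => /= [[/imfsetP[i _ ->]] | [i _ ->]]; last first.
  by rewrite size_window X_window.
rewrite size_take_min size_drop size_hash_pad => size_i.
(* Full length [2k-1] inside a string of length [n + 2(k-1)] leaves only starts below [n]. *)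
have lt_in : i < n by lia.
exists (class_min (Ordinal lt_in)); first exact: class_min_in.
by rewrite window_class_min windowE.
Qed.

Lemma card_class_minima : 0 < n -> 0 < k ->
  #|class_minima k S| =
  #|` deepest_leaves (truncated_suffix_tree (2 * k).-1 (hash_pad k S))|.
Proof.
move=> n_gt0 k_gt0; rewrite deepest_leaves_windows // card_in_imfset.
  by rewrite cardE.
exact: class_minima_inj.
Qed.

End AttractorTheory.

(** * Assembling the set-cover reduction *)

Theorem theorem5 (n sigma k : nat) (S : n.-tuple 'I_sigma)
    (hn : 0 < n) (hk : 0 < k) :
  let P := attractor_set_cover k S in
  [/\ sc_universe P = ct_edges (truncated_suffix_tree k S),
      sc_size P =
        #|` deepest_leaves (truncated_suffix_tree (2 * k).-1 (hash_pad k S))|,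
      forall D : {set 'I_n}, sc_covers P D -> k_attractor k S D
    & forall G : {set 'I_n}, minimal_k_attractor k S G ->
      exists D : {set 'I_n}, sc_covers P D /\ #|D| = #|G|].
Proof.
split=> [// | | D [_ /fsubsetP covD] | G [attrG minG]].
- exact: card_class_minima.
- apply: marks_attractor => e /covD/bigfcupP[p /andP[_ Dp]].
  by rewrite in_fset => /andP[_ mark_p]; exists p.
exists (class_min k S @: G)%SET; split; last first.
  apply: card_in_imset => p q Gp Gq eq_pq; apply/eqP.
  have {}eq_pq : window k S p = window k S q.
    by rewrite -window_class_min eq_pq window_class_min.
  (* Two members of [G] in one class would allow [p] to be dropped, against minimality. *)
  apply: contraT => neq_pq.
  by case: (minG p Gp); exact: k_attractor_window Gq eq_pq neq_pq.
split; first by apply/subsetP => _ /imsetP[p _ ->]; exact: class_min_in.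
apply/fsubsetP => e Ee; have [p Gp mark_p] := attractor_marks attrG Ee.
apply/bigfcupP; exists (class_min k S p); first by rewrite mem_index_enum imset_f.
rewrite in_fset; apply/andP; split=> //.
have [e_size _] := edge_occurs Ee.
exact: marks_window (esym (window_class_min k S p)) e_size mark_p.
Qed.
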